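(* Let $n\ge1$ be an integer, $1<p<\infty$ and $L\in\mathbb{R}$. On $\mathbb{H}^n$ let $$v=\Big(\sum_{j=1}^{2n}x_j^2\Big)-4iz,\qquad w=\Big(\sum_{j=1}^{2n}x_j^2\Big)+4iz,$$ and $$u=u_{p,L}=\begin{cases} v^{\eta}w^{\tau}, & p\neq 2n+2,\\ \log\big(v^{1-L}w^{1+L}\big), & p=2n+2,\end{cases}\qquad \eta=\frac{2n+2-p}{4(1-p)}(1-L),\quad \tau=\frac{2n+2-p}{4(1-p)}(1+L).$$ Let $\Upsilon=(\Upsilon_1,\dots,\Upsilon_{2n})$ with $\Upsilon_k=X_ku+iLX_{n+k}u$ for $1\le k\le n$ and $\Upsilon_k=X_ku-iLX_{k-n}u$ for $n+1\le k\le 2n$. Then in $\mathbb{H}^n\setminus\{0\}$, $$\overline{\Delta_p}u:=\sum_{j=1}^{2n}X_j\big(\|\Upsilon\|^{p-2}\Upsilon_j\big)=0.$$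
   Context: $\mathbb{H}^n$ is $\mathbb{R}^{2n+1}$ with coordinates $(x_1,\dots,x_{2n},z)$ and the vector fields $X_i=\frac{\partial}{\partial x_i}-\frac{x_{n+i}}{2}\frac{\partial}{\partial z}$ for $1\le i\le n$ and $X_i=\frac{\partial}{\partial x_i}+\frac{x_{i-n}}{2}\frac{\partial}{\partial z}$ for $n<i\le2n$. For $\Upsilon$ with complex entries, $\|\Upsilon\|^2=\sum_{j=1}^{2n}\Upsilon_j\overline{\Upsilon_j}$; the vector $\|\Upsilon\|^{p-2}\Upsilon$ is understood to be $0$ where $\Upsilon=0$. Complex powers and logarithms of $v$ and $w=\overline v$ are taken with the principal branch (both have nonnegative real part and vanish only at the origin), and $\log(v^{1-L}w^{1+L})$ means $(1-L)\log v+(1+L)\log w$. *)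

(* Defs.v *)
From mathcomp Require Import all_boot all_order all_algebra.
From mathcomp Require Import complex.
From mathcomp Require Import all_classical all_reals all_analysis.

Set Implicit Arguments.
Unset Strict Implicit.
Unset Printing Implicit Defensive.

Import Order.TTheory GRing.Theory Num.Theory.
Import numFieldNormedType.Exports.

Local Open Scope ring_scope.
Local Open Scope complex_scope.

(* Num.Theory shadows these with the projections R[i] -> R[i]. *)
Local Notation Re := complex.Re.
Local Notation Im := complex.Im.

Section ComplexFunctions.
Variable R : realType.
Implicit Types z a : R[i].

(* Principal argument: for z != 0 it lies in ]-pi, pi]. *)
Definition Carg z : R :=
  let t := acos (Re z / Normc.normc z) in if 0 <= Im z then t else - t.

(* Principal logarithm; its value at 0 is junk. *)
Definition Clog z : R[i] := ln (Normc.normc z) +i* Carg z.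

Definition Cexp z : R[i] := (expR (Re z))%:C * (cos (Im z) +i* sin (Im z)).

(* Principal power, with the same convention as powR at z = 0. *)
Definition Cpow z a : R[i] :=
  if z == 0 then (a == 0)%:R else Cexp (a * Clog z).

End ComplexFunctions.

Section Heisenberg.
Variables (R : realType) (n : nat).

Definition heis := 'rV[R]_(n + n + 1).

(* Indices are 0-based: the coordinates x_k and x_(n+k), 1 <= k <= n, are
   [hx P (lshift n k)] and [hx P (rshift n k)] with k : 'I_n. *)
Definition hx (P : heis) (j : 'I_(n + n)) : R := P ord0 (lshift 1 j).
Definition hz (P : heis) : R := P ord0 (rshift (n + n) ord0).

Definition dir_x (j : 'I_(n + n)) : heis := delta_mx ord0 (lshift 1 j).
Definition dir_z : heis := delta_mx ord0 (rshift (n + n) ord0).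

(* R[i] carries no normed-module structure over R in the library, so
   derivatives of complex-valued functions are taken componentwise. *)
Definition cderivable (f : heis -> R[i]) (P e : heis) : Prop :=
  derivable (fun Q => Re (f Q)) P e /\ derivable (fun Q => Im (f Q)) P e.

Definition cderive (f : heis -> R[i]) (P e : heis) : R[i] :=
  'D_e (fun Q => Re (f Q)) P +i* 'D_e (fun Q => Im (f Q)) P.

(* Coefficient of d/dz in the vector field X_j. *)
Definition Xcoef (j : 'I_(n + n)) (P : heis) : R :=
  match fintype.split j with
  | inl k => - (hx P (rshift n k) / 2)
  | inr k => hx P (lshift n k) / 2
  end.

Definition X (j : 'I_(n + n)) (f : heis -> R[i]) (P : heis) : R[i] :=
  cderive f P (dir_x j) + (Xcoef j P)%:C * cderive f P dir_z.

(* [cderive] is total, with an unspecified value where the limit does not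
   exist; X j f P is meaningful when X_derivable j f P holds. *)
Definition X_derivable (j : 'I_(n + n)) (f : heis -> R[i]) (P : heis) : Prop :=
  cderivable f P (dir_x j) /\ cderivable f P dir_z.

Definition Upsilon (L : R) (u : heis -> R[i]) (j : 'I_(n + n)) (P : heis) :
    R[i] :=
  match fintype.split j with
  | inl k => X (lshift n k) u P + 'i%C * L%:C * X (rshift n k) u P
  | inr k => X (rshift n k) u P - 'i%C * L%:C * X (lshift n k) u P
  end.

(* The sum below is a nonnegative real. *)
Definition Upsilon_norm (L : R) (u : heis -> R[i]) (P : heis) : R :=
  Num.sqrt (Re (\sum_(j < n + n) Upsilon L u j P * (Upsilon L u j P)^*%C)).

(* Since 0 `^ a is 0 or 1, this is 0 where Upsilon = 0, also for p < 2. *)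
Definition flux (p L : R) (u : heis -> R[i]) (j : 'I_(n + n)) (P : heis) :
    R[i] :=
  (Upsilon_norm L u P `^ (p - 2))%:C * Upsilon L u j P.

Definition pLaplacian (p L : R) (u : heis -> R[i]) (P : heis) : R[i] :=
  \sum_(j < n + n) X j (flux p L u j) P.

Definition sqnorm_x (P : heis) : R := \sum_(j < n + n) hx P j ^+ 2.

Definition v (P : heis) : R[i] := sqnorm_x P -i* (4 * hz P).
Definition w (P : heis) : R[i] := sqnorm_x P +i* (4 * hz P).

Definition eta (p L : R) : R :=
  (2 * n%:R + 2 - p) / (4 * (1 - p)) * (1 - L).
Definition tau (p L : R) : R :=
  (2 * n%:R + 2 - p) / (4 * (1 - p)) * (1 + L).

Definition u (p L : R) (P : heis) : R[i] :=
  if p == 2 * n%:R + 2 then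
    (1 - L)%:C * Clog (v P) + (1 + L)%:C * Clog (w P)
  else Cpow (v P) (eta p L)%:C * Cpow (w P) (tau p L)%:C.

End Heisenberg.

Arguments u {R} n p L P.

(* Main.v *)
Require Import Defs.
From mathcomp Require Import all_boot all_order all_algebra.
From mathcomp Require Import complex.
From mathcomp Require Import all_classical all_reals all_analysis.
From mathcomp Require Import ring lra.

Import Order.TTheory GRing.Theory Num.Theory.
Import numFieldNormedType.Exports.

Local Open Scope ring_scope.

(** Write s for the sum of the x_j ^ 2, and pass to the polar coordinates
    l = ln |w| and t = arg w; they are real and smooth away from the origin, and
    v is the conjugate of w.  Then u is exp(2c(l + iLt)) with
    c = (2n+2-p) / (4(1-p)), or 2(l + iLt) when p = 2n+2.

    The pair (l, t) is conjugate along the fields: if k <= n then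
    X_(n+k) l = - X_k t and X_(n+k) t = X_k l ([ln_num_rshift] and
    [arg_num_rshift]), because w is annihilated by every X_k + i X_(n+k).
    Therefore, if X_j u = D (X_j l + iL X_j t) for every j, the combination
    defining Upsilon cancels the terms in t and leaves
    Upsilon_j = D (1 - L ^ 2) X_j l ([Upsilon_conjugate]).  As the X_j l have
    square sum 4 s / |w| ^ 2, the field |Upsilon| ^ (p-2) Upsilon_j is a
    constant times

        exp(a l) s ^ q g(t) A_j,  q = (p-2)/2,  a = - (n + q + 2),

    where A_j = |w| ^ 2 X_j l and g is exp(ib.) for some real b
    ([flux_model_field]); both cases of u give the same exponent a.

    Where s > 0 this field has divergence zero whatever g is
    ([model_field_divergence]): the derivative of g is paired with the sum of
    X_j t X_j l, which vanishes by conjugacy, and the remaining terms add up to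
    4 s (a + q + n + 2) times a common factor, where a + q + n + 2 = 0.

    On the center s = 0, where s ^ q is not differentiable, the divergence is
    zero term by term ([is_X_model_field_center]).  Along the x_j-axis through
    such a point s ^ q A_j restricts to 2 (h ^ 2) ^ q h ^ 3, which is
    o(h) because p > 0, and along the z-axis it is identically zero. *)

(** * Derivatives along lines *)

Section DirectionalDerivatives.
Set Implicit Arguments.
Unset Strict Implicit.
Context {R : realType} {V : normedModType R}.
Implicit Types (f : V -> R) (P e : V).

Lemma is_derive_line f P e d :
  is_derive P e f d <-> is_derive (0 : R) 1 (fun h => f (h *: e + P)) d.
Proof.
have E : 'D_e f P = 'D_1 (fun h : R => f (h *: e + P)) (0 : R).
  rewrite /derive; set g1 := fun h => h^-1 *: _; set g2 := fun h => h^-1 *: _.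
  suff -> : g1 = g2 by [].
  by apply/funext => h; rewrite /g1 /g2 /= addr0 scale0r add0r [_%:A]mulr1.
split=> -[df dE]; split; rewrite ?E // -?E //.
  exact: (derivable1P _ _ _).1.
exact: (derivable1P _ _ _).2.
Qed.

(** Only the directional derivative of the inner function is assumed to exist,
    so the chain rule for differentials does not apply; the one-variable chain
    rule on the line through P does. *)
Lemma is_derive_comp (g : R -> R) f P e (a d : R) :
  is_derive (f P) 1 g a -> is_derive P e f d ->
  is_derive P e (fun Q => g (f Q)) (a * d).
Proof.
move=> ga /is_derive_line fd; apply/is_derive_line => /=.
by apply: (@is_derive1_comp R g (fun h => f (h *: e + P)));
  rewrite ?scale0r ?add0r.
Qed.

End DirectionalDerivatives.

(** * The fields X_j as derivations *)

Section LeftInvariantFields.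
Set Implicit Arguments.
Unset Strict Implicit.
Context {R : realType} {n : nat}.
Local Notation heis := (heis R n).
Implicit Types (j k : 'I_(n + n)) (P Q : heis) (f g : heis -> R).
Local Open Scope classical_set_scope.

(** Existence and value are bundled, as in [is_derive], so that the rules of
    calculus can be chained without separate derivability side conditions. *)
Definition is_X j P f (d : R) : Prop :=
  exists a b : R, [/\ is_derive P (dir_x R j) f a,
    is_derive P (dir_z R n) f b & d = a + Xcoef j P * b].

Lemma is_X_eq j P f d d' : is_X j P f d -> d = d' -> is_X j P f d'.
Proof. by move=> h <-. Qed.

Lemma is_X_near j P f g d :
  (\near P, f P = g P) -> is_X j P f d -> is_X j P g d.
Proof.
move=> fg [a [b [fa fb ->]]]; exists a, b.
by split=> //; apply: near_eq_is_derive fg _.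
Qed.

Lemma is_X_cst j P (c : R) : is_X j P (fun=> c) 0.
Proof.
by exists 0, 0; split; rewrite ?mulr0 ?addr0//; exact: is_derive_cst.
Qed.

Lemma is_XD j P f g d d' :
  is_X j P f d -> is_X j P g d' -> is_X j P (fun Q => f Q + g Q) (d + d').
Proof.
move=> [a [b [fa fb ->]]] [a' [b' [ga gb ->]]]; exists (a + a'), (b + b').
by split; [exact: is_deriveD|exact: is_deriveD|ring].
Qed.

Lemma is_XM j P f g d d' :
  is_X j P f d -> is_X j P g d' ->
  is_X j P (fun Q => f Q * g Q) (f P * d' + g P * d).
Proof.
move=> [a [b [fa fb ->]]] [a' [b' [ga gb ->]]].
exists (f P * a' + g P * a), (f P * b' + g P * b).
by split; [exact: is_deriveM|exact: is_deriveM|ring].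
Qed.

Lemma is_XZ j P (c : R) f d :
  is_X j P f d -> is_X j P (fun Q => c * f Q) (c * d).
Proof.
move=> fd; apply: is_X_eq (is_XM (is_X_cst j P c) fd) _.
by rewrite mulr0 addr0.
Qed.

Lemma is_XX2 j P f d :
  is_X j P f d -> is_X j P (fun Q => f Q ^+ 2) (2 * f P * d).
Proof.
move=> fd; rewrite (_ : (fun _ => _) = (fun Q => f Q * f Q)) //.
by apply: is_X_eq (is_XM fd fd) _; ring.
Qed.

Lemma is_X_comp j P (g : R -> R) f a d :
  is_derive (f P) 1 g a -> is_X j P f d -> is_X j P (fun Q => g (f Q)) (a * d).
Proof.
move=> ga [b [b' [fb fb' ->]]]; exists (a * b), (a * b').
by split; [exact: is_derive_comp|exact: is_derive_comp|ring].
Qed.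

Lemma is_XV j P f d : f P != 0 -> is_X j P f d ->
  is_X j P (fun Q => (f Q)^-1) (- (f P) ^- 2 * d).
Proof.
move=> f0; apply: is_X_comp; apply: is_derive_eq.
  by apply: (@is_deriveV R id) => //; exact: is_derive_id.
by rewrite [LHS]mulr1.
Qed.

Lemma is_X_sum j P m (F : 'I_m -> heis -> R) (d : 'I_m -> R) :
  (forall i, is_X j P (F i) (d i)) ->
  is_X j P (fun Q => \sum_(i < m) F i Q) (\sum_(i < m) d i).
Proof.
move=> Fd; elim: m F d Fd => [|m IH] F d Fd.
  by under eq_fun do rewrite big_ord0; rewrite big_ord0; exact: is_X_cst.
under eq_fun do rewrite big_ord_recr /=.
by rewrite big_ord_recr; apply: is_XD => //; exact: IH.
Qed.

Lemma is_derive_coord P (e : heis) (i : 'I_(n + n + 1)) :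
  is_derive P e (fun Q : heis => Q ord0 i) (e ord0 i).
Proof.
apply/is_derive_line.
under eq_fun do rewrite !mxE.
apply: is_derive_eq.
by rewrite /GRing.scale/=; ring.
Qed.

Lemma is_X_hx j P k : is_X j P (fun Q => hx Q k) (k == j)%:R.
Proof.
exists (k == j)%:R, 0; split; last by ring.
- apply: is_derive_eq; first exact: is_derive_coord.
  by rewrite /dir_x mxE eqxx (inj_eq (@lshift_inj _ _)).
- apply: is_derive_eq; first exact: is_derive_coord.
  by rewrite /dir_z mxE eqxx eq_lrshift.
Qed.

Lemma is_X_hz j P : is_X j P (@hz R n) (Xcoef j P).
Proof.
exists 0, 1; split; last by ring.
- apply: is_derive_eq; first exact: is_derive_coord.
  by rewrite /dir_x mxE eqxx eq_rlshift.
- apply: is_derive_eq; first exact: is_derive_coord.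
  by rewrite /dir_z mxE !eqxx.
Qed.

(** The coefficient of d/dz in X_j is a multiple of the coordinate conjugate to
    x_j, hence constant along both directions of which X_j is made. *)
Lemma is_X_Xcoef j P : is_X j P (Xcoef j) 0.
Proof.
rewrite /Xcoef; case: split_ordP => k ->.
- rewrite (_ : (fun _ => _) = fun Q : heis => - (2^-1) * hx Q (rshift n k)).
    apply: is_X_eq; first by apply: is_XZ; exact: is_X_hx.
    by rewrite eq_rlshift mulr0.
  by apply/funext => Q; field.
- rewrite (_ : (fun _ => _) = fun Q : heis => (2^-1) * hx Q (lshift n k)).
    apply: is_X_eq; first by apply: is_XZ; exact: is_X_hx.
    by rewrite eq_lrshift mulr0.
  by apply/funext => Q; field.
Qed.

End LeftInvariantFields.

(** * The principal argument in the slit plane *)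

Section Argument.
Set Implicit Arguments.
Unset Strict Implicit.
Context {R : realType}.
Implicit Types a b N : R.
Local Open Scope complex_scope.

(** Both sides are the angle in [0, pi[ whose cosine is a / N: the tangent of
    half that angle is b / (N + a). *)
Lemma acos_half a b N :
  0 <= b -> 0 < N -> 0 < N + a -> N ^+ 2 = a ^+ 2 + b ^+ 2 ->
  acos (a / N) = 2 * atan (b / (N + a)).
Proof.
move=> b0 N0 Na0 NE; set y := atan _.
have NZ : N != 0 by rewrite gt_eqF.
have NaZ : N + a != 0 by rewrite gt_eqF.
have y0 : 0 <= y.
  rewrite /y -(@atan0 R); have [->|lt0] := eqVneq b 0; first by rewrite mul0r.
  by apply/ltW/lt_atan; rewrite divr_gt0// lt_neqAle eq_sym lt0.
have ypi : y < pi / 2 by exact: atan_ltpi2.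
have -> : a / N = cos (2 * y).
  rewrite mulr_natl cos_mulr2n /y cos_atan exprVn sqr_sqrtr; last first.
    by rewrite addr_ge0// sqr_ge0.
  have -> : 1 + (b / (N + a)) ^+ 2 = 2 * N / (N + a).
    rewrite expr_div_n (_ : b ^+ 2 = N ^+ 2 - a ^+ 2); first by field.
    by rewrite NE; ring.
  by rewrite -mulr_natr; field; rewrite NaZ NZ.
by rewrite cosK// in_itv/=; apply/andP; split; lra.
Qed.

(** The definition of [Carg] through [acos] is not differentiable as it stands
    on the positive real axis, where [acos] has an infinite slope and the two
    signs are glued; the half-angle formula is smooth on the plane slit along
    the closed negative real axis. *)
Lemma Carg_half a b :
  let N := Num.sqrt (a ^+ 2 + b ^+ 2) in
  0 < N + a -> Carg (a +i* b) = 2 * atan (b / (N + a)).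
Proof.
move=> N Na0; have NE : N ^+ 2 = a ^+ 2 + b ^+ 2.
  by rewrite sqr_sqrtr// addr_ge0 ?sqr_ge0.
have N0 : 0 < N.
  rewrite lt_neqAle sqrtr_ge0 andbT; apply/eqP => N0.
  move: Na0 NE; rewrite -N0; nra.
rewrite /Carg /= -/N; case: ifPn => [b0|]; first exact: acos_half.
rewrite -ltNge => b0; rewrite (@acos_half a (- b) N) ?oppr_ge0 ?ltW ?sqrrN//.
by rewrite mulNr atanN; ring.
Qed.

End Argument.

(** * Polar coordinates of w and their derivatives *)

Section PolarCoordinates.
Set Implicit Arguments.
Unset Strict Implicit.
Context {R : realType} {n : nat}.
Local Notation heis := (heis R n).
Local Notation s := (@sqnorm_x R n).
Local Notation z := (@hz R n).
Implicit Types (j : 'I_(n + n)) (k : 'I_n) (P Q : heis).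
Local Open Scope classical_set_scope.
Local Open Scope complex_scope.

Definition sqnormw Q : R := s Q ^+ 2 + (4 * z Q) ^+ 2.
Definition normw Q : R := Num.sqrt (sqnormw Q).
Definition ln_normw Q : R := ln (normw Q).
Definition argw Q : R := Carg (w Q).

Lemma sqnorm_x_ge0 Q : 0 <= s Q.
Proof. by apply: sumr_ge0 => i _; exact: sqr_ge0. Qed.

Lemma sqnorm_x_eq0 Q : s Q = 0 -> forall j, hx Q j = 0.
Proof.
move=> /eqP; rewrite psumr_eq0 => [/allP h j|i _]; last exact: sqr_ge0.
by apply/eqP; rewrite -sqrf_eq0; apply: h; rewrite mem_index_enum.
Qed.

Lemma sqnormw_gt0 Q : Q != 0 -> 0 < sqnormw Q.
Proof.
apply: contra_neqT; rewrite -leNgt /sqnormw => h.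
have s0 : s Q = 0 by apply/eqP; rewrite -sqrf_eq0; apply/eqP; nra.
have z0 : z Q = 0 by nra.
apply/rowP => i; rewrite mxE; case: (split_ordP i) => [j ->|j ->].
  exact: (sqnorm_x_eq0 s0 j).
by rewrite (ord1 j); exact: z0.
Qed.

Lemma normw_gt0 Q : Q != 0 -> 0 < normw Q.
Proof. by move=> Q0; rewrite sqrtr_gt0 sqnormw_gt0. Qed.

Lemma normw_sqr Q : normw Q ^+ 2 = s Q ^+ 2 + (4 * z Q) ^+ 2.
Proof. by rewrite sqr_sqrtr// addr_ge0 ?sqr_ge0. Qed.

Lemma expR_ln_normw Q (a : R) : Q != 0 ->
  expR (a * ln_normw Q) * normw Q ^+ 2 = expR ((a + 2) * ln_normw Q).
Proof.
move=> Q0; rewrite mulrDl expRD; congr (_ * _).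
by rewrite expRM_natl lnK// posrE normw_gt0.
Qed.

Lemma near_neq0 P : P != 0 -> \near P, P != 0.
Proof.
by move=> P0; apply: (@cvgr_neq0 _ _ _ (nbhs P) _ id P) => //; exact: cvg_id.
Qed.

Lemma argwE Q : Q != 0 -> argw Q = 2 * atan (4 * z Q / (normw Q + s Q)).
Proof.
move=> Q0; apply: Carg_half.
by rewrite ltr_wpDr ?sqnorm_x_ge0// normw_gt0.
Qed.

(** This would fail on the negative real axis, which w avoids because its real
    part is s. *)
Lemma Carg_v Q : Q != 0 -> Carg (v Q) = - argw Q.
Proof.
move=> Q0; have N0 : 0 < normw Q + s Q.
  by rewrite ltr_wpDr ?sqnorm_x_ge0// normw_gt0.
by rewrite argwE// Carg_half sqrrN// mulNr atanN mulrN.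
Qed.

Lemma Clog_w Q : Clog (w Q) = ln_normw Q +i* argw Q.
Proof. by []. Qed.

Lemma Clog_v Q : Q != 0 -> Clog (v Q) = ln_normw Q -i* argw Q.
Proof. by move=> Q0; rewrite /Clog Carg_v //= sqrrN. Qed.

(** These are |w| ^ 2 X_j (ln |w|) and |w| ^ 2 X_j (arg w), the real and
    imaginary parts of (X_j w) v; clearing the denominator makes them
    polynomials. *)
Definition ln_num j Q : R := 2 * s Q * hx Q j + 16 * z Q * Xcoef j Q.
Definition arg_num j Q : R := 4 * s Q * Xcoef j Q - 8 * z Q * hx Q j.

Lemma is_X_sqnorm_x j P : is_X j P s (2 * hx P j).
Proof.
apply: is_X_eq; first by apply: is_X_sum => i; apply: is_XX2; exact: is_X_hx.
rewrite (bigD1 j)//= eqxx mulr1 big1 ?addr0// => i /negbTE ->.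
by rewrite mulr0.
Qed.

Lemma is_X_sqnormw j P : is_X j P sqnormw (2 * ln_num j P).
Proof.
apply: is_X_eq; first apply: is_XD; first exact/is_XX2/is_X_sqnorm_x.
  exact/is_XX2/is_XZ/is_X_hz.
by rewrite /ln_num; ring.
Qed.

Lemma is_X_normw j P : P != 0 -> is_X j P normw (ln_num j P / normw P).
Proof.
move=> P0; have /lt0r_neq0 N0 := normw_gt0 P0.
have dsqrt : is_derive (sqnormw P) 1 Num.sqrt (2 * normw P)^-1.
  by apply: is_derive1_sqrt; exact: sqnormw_gt0.
by apply: is_X_eq (is_X_comp dsqrt (is_X_sqnormw j P)) _; field.
Qed.

Lemma is_X_ln_normw j P :
  P != 0 -> is_X j P ln_normw (ln_num j P / normw P ^+ 2).
Proof.
move=> P0; have N0 := normw_gt0 P0.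
apply: is_X_eq (is_X_comp (is_derive1_ln N0) (is_X_normw j P0)) _.
by field; rewrite gt_eqF.
Qed.

Lemma is_X_argw j P : P != 0 -> is_X j P argw (arg_num j P / normw P ^+ 2).
Proof.
move=> P0; have N0 := normw_gt0 P0.
have Ns0 : 0 < normw P + s P by rewrite ltr_wpDr ?sqnorm_x_ge0.
have argE : \near P, 2 * atan (4 * z P * (normw P + s P)^-1) = argw P.
  by near=> Q; rewrite argwE//; near: Q; exact: near_neq0.
apply: is_X_near argE _.
have XV := is_XV (lt0r_neq0 Ns0) (is_XD (is_X_normw j P0) (is_X_sqnorm_x j P)).
have XT := is_XM (is_XZ 4 (is_X_hz j P)) XV.
apply: is_X_eq (is_XZ 2 (is_X_comp (is_derive1_atan _) XT)) _.
have NE := normw_sqr P.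
have -> : 1 + (4 * z P / (normw P + s P)) ^+ 2
    = 2 * normw P / (normw P + s P).
  rewrite expr_div_n (_ : (4 * z P) ^+ 2 = normw P ^+ 2 - s P ^+ 2).
    by field; rewrite gt_eqF.
  by rewrite NE; ring.
rewrite /ln_num /arg_num.
have NZ : normw P != 0 by rewrite gt_eqF.
have NsZ : normw P + s P != 0 by rewrite gt_eqF.
(* Clear denominators, then use |w| ^ 2 = s ^ 2 + 16 z ^ 2 to factor out
   |w| + s. *)
apply: (mulIf (x := normw P ^+ 2 * (normw P + s P) * 2)).
  by rewrite !mulf_neq0// sqrf_eq0.
set N := normw P in NE NZ NsZ *.
transitivity (2 * (4 * Xcoef j P * N * (N + s P) - 4 * z P *
    (2 * s P * hx P j + 16 * z P * Xcoef j P + 2 * hx P j * N))).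
  by field; rewrite NZ NsZ.
transitivity (2 * (N + s P) * (4 * s P * Xcoef j P - 8 * z P * hx P j));
  last by field.
rewrite (_ : 4 * Xcoef j P * N * (N + s P)
    = 4 * Xcoef j P * (s P ^+ 2 + (4 * z P) ^+ 2 + s P * N)).
  by ring.
by rewrite -NE; ring.
Unshelve. all: by end_near. Qed.

Lemma is_X_ln_num j P :
  is_X j P (ln_num j) (2 * s P + 4 * hx P j ^+ 2 + 16 * Xcoef j P ^+ 2).
Proof.
have Xx : is_X j P (fun Q => hx Q j) 1.
  by apply: is_X_eq (is_X_hx j P j) _; rewrite eqxx.
apply: is_X_eq.
  apply: is_XD.
    by apply: is_XM Xx; apply: is_XZ; exact: is_X_sqnorm_x.
  by apply: is_XM; [apply: is_XZ; exact: is_X_hz|exact: is_X_Xcoef].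
by rewrite /=; ring.
Qed.

(** * Conjugacy of the polar coordinates *)

Lemma Xcoef_lshift k Q : Xcoef (lshift n k) Q = - (hx Q (rshift n k) / 2).
Proof. by rewrite /Xcoef -[lshift n k]/(unsplit (inl k)) unsplitK. Qed.

Lemma Xcoef_rshift k Q : Xcoef (rshift n k) Q = hx Q (lshift n k) / 2.
Proof. by rewrite /Xcoef -[rshift n k]/(unsplit (inr k)) unsplitK. Qed.

(** This and [arg_num_rshift] are the Cauchy-Riemann equations expressing that
    X_(n+k) w = i X_k w. *)
Lemma ln_num_rshift k Q : ln_num (rshift n k) Q = - arg_num (lshift n k) Q.
Proof. by rewrite /ln_num /arg_num Xcoef_rshift Xcoef_lshift; field. Qed.

Lemma arg_num_rshift k Q : arg_num (rshift n k) Q = ln_num (lshift n k) Q.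
Proof. by rewrite /ln_num /arg_num Xcoef_rshift Xcoef_lshift; field. Qed.

Lemma sum_hx_Xcoef Q : \sum_j hx Q j * Xcoef j Q = 0.
Proof.
rewrite big_split_ord/= -big_split big1// => k _.
by rewrite Xcoef_lshift Xcoef_rshift /=; field.
Qed.

Lemma sum_Xcoef_sqr Q : \sum_j Xcoef j Q ^+ 2 = s Q / 4.
Proof.
rewrite /sqnorm_x !big_split_ord/= mulrDl [LHS]addrC !mulr_suml; congr (_ + _);
  by apply: eq_bigr => k _; rewrite (Xcoef_lshift, Xcoef_rshift); field.
Qed.

Lemma sum_hx_ln_num Q : \sum_j hx Q j * ln_num j Q = 2 * s Q ^+ 2.
Proof.
rewrite (eq_bigr (fun j => 2 * s Q * hx Q j ^+ 2
    + 16 * z Q * (hx Q j * Xcoef j Q))); last first.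
  by move=> j _; rewrite /ln_num; ring.
by rewrite big_split/= -!mulr_sumr sum_hx_Xcoef -/(s Q); ring.
Qed.

Lemma sum_Xcoef_ln_num Q : \sum_j Xcoef j Q * ln_num j Q = 4 * z Q * s Q.
Proof.
rewrite (eq_bigr (fun j => 2 * s Q * (hx Q j * Xcoef j Q)
    + 16 * z Q * Xcoef j Q ^+ 2)); last first.
  by move=> j _; rewrite /ln_num; ring.
by rewrite big_split/= -!mulr_sumr sum_hx_Xcoef sum_Xcoef_sqr; field.
Qed.

Lemma sum_ln_num_sqr Q : \sum_j ln_num j Q ^+ 2 = 4 * s Q * normw Q ^+ 2.
Proof.
rewrite (eq_bigr (fun j => 2 * s Q * (hx Q j * ln_num j Q)
    + 16 * z Q * (Xcoef j Q * ln_num j Q))); last first.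
  by move=> j _; rewrite expr2 {1}/ln_num; ring.
rewrite big_split/= -!mulr_sumr sum_hx_ln_num sum_Xcoef_ln_num normw_sqr.
by ring.
Qed.

(** The terms of index k and n+k cancel, by conjugacy. *)
Lemma sum_arg_num_ln_num Q : \sum_j arg_num j Q * ln_num j Q = 0.
Proof.
rewrite big_split_ord/= -big_split big1//= => k _.
by rewrite ln_num_rshift arg_num_rshift /=; ring.
Qed.

(** The divergence of the field [ln_num], summing [is_X_ln_num] over j. *)
Lemma sum_is_X_ln_num P :
  \sum_j (2 * s P + 4 * hx P j ^+ 2 + 16 * Xcoef j P ^+ 2)
    = (4 * n%:R + 8) * s P.
Proof.
rewrite !big_split/= -!mulr_sumr sum_Xcoef_sqr -/(s P) sumr_const card_ord.
by rewrite -[_ *+ (n + n)]mulr_natr natrD; field.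
Qed.

End PolarCoordinates.

(** * Divergence-free fields *)

Section Divergence.
Set Implicit Arguments.
Unset Strict Implicit.
Context {R : realType} {n : nat}.
Local Notation heis := (heis R n).
Local Notation s := (@sqnorm_x R n).
Implicit Types (j : 'I_(n + n)) (P Q : heis).
Local Open Scope classical_set_scope.

(** The difference quotient at 0 is (h ^ 2) ^ (q + 1), which tends to 0; stated
    through Caratheodory's form of the derivative. *)
Lemma is_derive_powR_sqr_cube (q : R) : 0 < q + 1 ->
  is_derive (0 : R) 1 (fun h => (h ^+ 2) `^ q * h ^+ 3) 0.
Proof.
move=> q1; apply/is_derive1_caratheodory; exists (fun h => (h ^+ 2) `^ (q + 1)).
split; last by rewrite expr0n powR0 ?gt_eqF.
- move=> h /=; rewrite !expr0n mulr0 !subr0.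
  have [->|h0] := eqVneq h 0; first by rewrite !expr0n !mulr0.
  rewrite powRD ?powRr1 ?sqr_ge0 ?sqrf_eq0 ?h0 ?implybT//.
  by ring.
- suff : (h ^+ 2) `^ (q + 1) @[h --> (0 : R)] --> (0 : R).
    by rewrite /prop_for /continuous_at /= expr0n powR0 ?gt_eqF.
  apply/cvgrPdist_lt => e e0; near=> h.
  rewrite sub0r normrN ger0_norm ?powR_ge0//.
  have -> : e = (e `^ (q + 1)^-1) `^ (q + 1).
    by rewrite -powRrM mulVf ?gt_eqF// powRr1// ltW.
  apply: gt0_ltr_powR; rewrite ?nnegrE ?sqr_ge0 ?powR_ge0//.
  near: h.
  have c0 : h ^+ 2 @[h --> (0 : R)] --> (0 : R).
    by have := @exprn_continuous R 2 0; rewrite /continuous_at expr0n.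
  by apply: (cvgr_lt _ c0); exact: powR_gt0.
Unshelve. all: by end_near. Qed.

(** The common shape of the real and imaginary parts of the flux of u, up to a
    constant factor, with g = cos (b .) and g = sin (b .).  The factor that may
    fail to be differentiable on the center is kept apart, on the right. *)
Definition model_field (a q : R) (g : R -> R) j Q : R :=
  expR (a * ln_normw Q) * g (argw Q) * (s Q `^ q * ln_num j Q).

Lemma is_X_polar (a : R) (g : R -> R) (g' : R) j P : P != 0 ->
  is_derive (argw P) 1 g g' ->
  is_X j P (fun Q => expR (a * ln_normw Q) * g (argw Q))
    (expR (a * ln_normw P) *
      (a * g (argw P) * ln_num j P + g' * arg_num j P) / normw P ^+ 2).
Proof.
move=> P0 gg'.
have XE := is_X_comp (is_derive_expR _) (is_XZ a (is_X_ln_normw j P0)).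
have XG := is_X_comp gg' (is_X_argw j P0).
by apply: is_X_eq (is_XM XE XG) _; ring.
Qed.

(** Up to the common factor exp(a l) s ^ q, the logarithmic derivatives of the
    factors exp(a l) and s ^ q contribute 4 a s g and 4 q s g, the divergence of
    [ln_num] contributes (4 n + 8) s g, and g' meets the vanishing sum
    [sum_arg_num_ln_num]. *)
Lemma model_field_divergence (q : R) (g : R -> R) (g' : R) P :
  let a := - (n%:R + q + 2) in
  P != 0 -> 0 < s P -> is_derive (argw P) 1 g g' ->
  exists d, (forall j, is_X j P (model_field a q g j) (d j)) /\ \sum_j d j = 0.
Proof.
move=> a P0 s0 gg'.
pose E := expR (a * ln_normw P); pose N := normw P.
have N0 : N != 0 by rewrite gt_eqF// normw_gt0.
have sZ : s P != 0 by rewrite gt_eqF.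
have Xfield j : is_X j P (model_field a q g j)
   (E * s P `^ q * (a * g (argw P) / N ^+ 2 * ln_num j P ^+ 2
     + g' / N ^+ 2 * (arg_num j P * ln_num j P)
     + g (argw P) * (2 * q / s P * (hx P j * ln_num j P)
       + (2 * s P + 4 * hx P j ^+ 2 + 16 * Xcoef j P ^+ 2)))).
  have XS := is_X_comp (is_derive1_powR q s0) (is_X_sqnorm_x j P).
  have XSA := is_XM XS (is_X_ln_num j P).
  apply: is_X_eq (is_XM (is_X_polar a j P0 gg') XSA) _.
  rewrite -/E -/N powRB ?powRr1 ?ltW// ?sZ ?implybT//.
  by field; rewrite N0 sZ.
eexists; split; first exact: Xfield.
rewrite -mulr_sumr !big_split/= -!mulr_sumr big_split/= sum_is_X_ln_num.
rewrite -mulr_sumr sum_ln_num_sqr sum_arg_num_ln_num sum_hx_ln_num -/N /a.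
by field; rewrite N0 sZ.
Qed.

(** The factor s ^ q A_j vanishes at P together with both of its directional
    derivatives, and the other factor is differentiable, so the product rule
    gives 0.  On the line through P in the direction x_j the coefficient of z
    in A_j vanishes, which leaves 2 (h ^ 2) ^ q h ^ 3. *)
Lemma is_X_model_field_center (a q : R) (g : R -> R) (g' : R) j P :
  0 < q + 1 -> P != 0 -> s P = 0 -> is_derive (argw P) 1 g g' ->
  is_X j P (model_field a q g j) 0.
Proof.
move=> q1 P0 s0 gg'; have hx0 := sqnorm_x_eq0 s0.
have c0 (Q : heis) : (forall i, i != j -> hx Q i = 0) -> Xcoef j Q = 0.
  rewrite /Xcoef; case: split_ordP => k -> Q0.
    by rewrite Q0 ?mul0r ?oppr0// eq_rlshift.
  by rewrite Q0 ?mul0r// eq_lrshift.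
have A0 : ln_num j P = 0 by rewrite /ln_num c0 ?hx0 ?mulr0 ?addr0.
have XSA : is_X j P (fun Q => s Q `^ q * ln_num j Q) 0.
  exists 0, 0; split; last by rewrite mulr0 addr0.
  - apply/is_derive_line.
    have hxj h i : hx (h *: dir_x R j + P) i = h * (i == j)%:R.
      rewrite /hx !mxE eqxx (inj_eq (@lshift_inj _ _)) /=.
      by rewrite [X in _ + X](hx0 i) addr0.
    have sh h : s (h *: dir_x R j + P) = h ^+ 2.
      rewrite /sqnorm_x (bigD1 j)//= hxj eqxx mulr1 big1 ?addr0// => i ij.
      by rewrite hxj (negbTE ij) mulr0 expr0n.
    have fE : (fun h => s (h *: dir_x R j + P) `^ q
          * ln_num j (h *: dir_x R j + P))
        = (fun h : R => 2 * ((h ^+ 2) `^ q * h ^+ 3)).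
      apply/funext => h; rewrite /ln_num sh hxj eqxx c0; last first.
        by move=> i /negbTE ij; rewrite hxj ij mulr0.
      by rewrite mulr1; ring.
    rewrite fE; apply: is_derive_eq.
      exact: (is_deriveZ 2 (is_derive_powR_sqr_cube q1)).
    by rewrite scaler0.
  - apply/is_derive_line.
    have hxz h i : hx (h *: dir_z R n + P) i = 0.
      by rewrite /hx !mxE eqxx eq_lrshift mulr0 add0r; exact: hx0.
    rewrite (_ : (fun h : R => _) = cst 0); first exact: is_derive_cst.
    by apply/funext => h; rewrite /ln_num c0 ?hxz ?mulr0 ?addr0 ?mulr0.
apply: is_X_eq (is_XM (is_X_polar a j P0 gg') XSA) _.
by rewrite A0; ring.
Qed.

End Divergence.

(** * The flux in polar coordinates *)

Section Flux.
Set Implicit Arguments.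
Unset Strict Implicit.
Context {R : realType} {n : nat}.
Local Notation heis := (heis R n).
Local Notation s := (@sqnorm_x R n).
Implicit Types (j : 'I_(n + n)) (P Q : heis) (f : heis -> R[i]).
Local Open Scope classical_set_scope.
Local Open Scope complex_scope.
Local Notation Re := complex.Re.
Local Notation Im := complex.Im.

Lemma sum_complex m (a b : 'I_m -> R) :
  \sum_j (a j +i* b j) = (\sum_j a j) +i* (\sum_j b j).
Proof.
elim: m a b => [|m IH] a b; first by rewrite !big_ord0.
by rewrite !big_ord_recl IH.
Qed.

Lemma sqrt_powR (x y : R) : 0 <= x -> Num.sqrt x `^ y = x `^ (y / 2).
Proof. by move=> x0; rewrite -powR12_sqrt// -powRrM mulrC. Qed.

Lemma is_X_complex j P f (a b : R) :
  is_X j P (fun Q => Re (f Q)) a -> is_X j P (fun Q => Im (f Q)) b ->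
  X_derivable j f P /\ X j f P = a +i* b.
Proof.
move=> [a1 [a2 [[da1 ea1] [da2 ea2] ->]]] [b1 [b2 [[db1 eb1] [db2 eb2] ->]]].
split; first by split; split.
rewrite /X /cderive ea1 ea2 eb1 eb2.
by apply/eqP; rewrite eq_complex /= mul0r subr0 mul0r addr0 !eqxx.
Qed.

(** With l = ln |w| and t = arg w, conjugacy turns the operator defining
    [Upsilon] into l |-> X_j l - i L X_j t and t |-> X_j t + i L X_j l; on
    l + i L t the two terms in X_j t cancel. *)
Lemma Upsilon_conjugate (L : R) f Q (D : R[i]) :
  (forall j, X j f Q = D * (ln_num j Q +i* (L * arg_num j Q))) ->
  forall j, Upsilon L f j Q = D * ((1 - L ^+ 2) * ln_num j Q)%:C.
Proof.
move=> XfE j; rewrite /Upsilon; case: split_ordP => k ->;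
  rewrite !XfE ln_num_rshift arg_num_rshift; case: D {XfE} => a b;
  apply/eqP; rewrite eq_complex /=; apply/andP; split; apply/eqP; ring.
Qed.

(** [sum_ln_num_sqr] turns the norm of Upsilon into a monomial in s and |w|.
    The constant is (k ^ 2) ^ q rather than a power of k, so that k may be
    negative or zero. *)
Lemma flux_model_field (p L k alpha b : R) f Q :
  Q != 0 ->
  (forall j, Upsilon L f j Q = (k * expR (alpha * ln_normw Q))%:C
     * (cos (b * argw Q) +i* sin (b * argw Q)) * (ln_num j Q)%:C) ->
  let q := (p - 2) / 2 in
  let K := k * (4 * k ^+ 2) `^ q in
  let a := 2 * (alpha + 1) * q + alpha in
  forall j, flux p L f j Q = (K * model_field a q (fun t => cos (b * t)) j Q)
    +i* (K * model_field a q (fun t => sin (b * t)) j Q).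
Proof.
move=> Q0 UE q K a j.
have normE : Upsilon_norm L f Q `^ (p - 2)
    = (4 * k ^+ 2) `^ q * expR (2 * (alpha + 1) * q * ln_normw Q) * s Q `^ q.
  have -> : Upsilon_norm L f Q
      = Num.sqrt (4 * k ^+ 2 * expR (2 * (alpha + 1) * ln_normw Q) * s Q).
    rewrite /Upsilon_norm; congr Num.sqrt.
    rewrite (eq_bigr (fun j =>
        (k ^+ 2 * expR (2 * (alpha * ln_normw Q)) * ln_num j Q ^+ 2) +i* 0));
      last first.
      move=> i _; rewrite UE -mulrA expRM_natl.
      set E := expR _; set t := b * _.
      have -> : k ^+ 2 * E ^+ 2 * ln_num i Q ^+ 2
          = (k * E * ln_num i Q) ^+ 2 * (cos t ^+ 2 + sin t ^+ 2).
        by rewrite cos2Dsin2; ring.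
      by apply/eqP; rewrite eq_complex /=; apply/andP; split; apply/eqP; ring.
    rewrite sum_complex /= -mulr_sumr sum_ln_num_sqr.
    by rewrite mulrDr mulr1 -expR_ln_normw// (mulrA 2 alpha); ring.
  have k2 : 0 <= 4 * k ^+ 2 by rewrite mulr_ge0 ?sqr_ge0.
  have kE : 0 <= 4 * k ^+ 2 * expR (2 * (alpha + 1) * ln_normw Q).
    by rewrite mulr_ge0 ?expR_ge0.
  rewrite sqrt_powR; last by rewrite mulr_ge0 ?sqnorm_x_ge0.
  rewrite -/q powRM ?sqnorm_x_ge0// powRM ?expR_ge0// -expRM.
  by congr (_ * expR _ * _); ring.
rewrite /flux normE UE /model_field /K /a [(_ + alpha) * _]mulrDl expRD.
by apply/eqP; rewrite eq_complex /=; apply/andP; split; apply/eqP; ring.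
Qed.

(** The exponent condition selects, among the fields of this form, those whose
    flux is the divergence-free one. *)
Lemma pLaplacian_polar (p L k alpha b : R) f :
  let q := (p - 2) / 2 in
  1 < p -> 2 * (alpha + 1) * q + alpha = - (n%:R + q + 2) ->
  (forall Q, Q != 0 -> forall j, Upsilon L f j Q
     = (k * expR (alpha * ln_normw Q))%:C
       * (cos (b * argw Q) +i* sin (b * argw Q)) * (ln_num j Q)%:C) ->
  forall P, P != 0 ->
    (forall j, X_derivable j (flux p L f j) P) /\ pLaplacian p L f P = 0.
Proof.
move=> q p1 aE UE P P0.
set a := - _ in aE; pose K := k * (4 * k ^+ 2) `^ q.
have divergence0 (g : R -> R) g' : is_derive (argw P) 1 g g' -> exists d,
    (forall j, is_X j P (model_field a q g j) (d j)) /\ \sum_j d j = 0.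
  move=> gg'; have [s0|s0] := eqVneq (s P) 0.
    exists (fun=> 0); split=> [j|]; last by rewrite big1.
    by apply: is_X_model_field_center gg' => //; rewrite /q; lra.
  apply: model_field_divergence gg' => //.
  by rewrite lt_neqAle eq_sym s0 sqnorm_x_ge0.
have [dc [Xc sc]] : exists d, (forall j,
    is_X j P (model_field a q (fun t => cos (b * t)) j) (d j))
    /\ \sum_j d j = 0.
  exact: divergence0.
have [ds [Xs ss]] : exists d, (forall j,
    is_X j P (model_field a q (fun t => sin (b * t)) j) (d j))
    /\ \sum_j d j = 0.
  exact: divergence0.
have XF j : X_derivable j (flux p L f j) P
    /\ X j (flux p L f j) P = (K * dc j) +i* (K * ds j).
  have fE : \near P, flux p L f j P
      = (K * model_field a q (fun t => cos (b * t)) j P)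
        +i* (K * model_field a q (fun t => sin (b * t)) j P).
    near=> Q; have Q0 : Q != 0 by near: Q; exact: near_neq0.
    by rewrite (flux_model_field p Q0 (UE Q Q0)) aE.
  apply: is_X_complex; (apply: is_X_near; last exact: is_XZ); near=> Q;
    by rewrite (near fE Q).
split=> [j|]; first by case: (XF j).
rewrite /pLaplacian (eq_bigr (fun j => (K * dc j) +i* (K * ds j))) => [|j _].
  by rewrite sum_complex -!mulr_sumr sc ss !mulr0.
by case: (XF j).
Unshelve. all: by end_near. Qed.

End Flux.

(** * The functions u in polar coordinates *)

Section Solutions.
Set Implicit Arguments.
Unset Strict Implicit.
Context {R : realType} {n : nat}.
Local Notation heis := (heis R n).
Local Notation u := (@u R n).
Implicit Types (j : 'I_(n + n)) (P Q : heis) (p L : R).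
Local Open Scope classical_set_scope.
Local Open Scope complex_scope.

Lemma CexpD (a b : R[i]) : Cexp (a + b) = Cexp a * Cexp b.
Proof.
case: a b => [a1 a2] [b1 b2]; rewrite /Cexp /= expRD cosD sinD.
by apply/eqP; rewrite eq_complex /=; apply/andP; split; apply/eqP; ring.
Qed.

(** The common factor of [eta] and [tau]; |u| = |w| ^ (2 c) for this c. *)
Definition half_degree p : R := (2 * n%:R + 2 - p) / (4 * (1 - p)).

Lemma w_neq0 Q : Q != 0 -> w Q != 0.
Proof.
move=> /sqnormw_gt0; apply: contraTneq => /eqP.
rewrite eq_complex /= => /andP[/eqP s0 /eqP z0].
by rewrite /sqnormw s0 z0 !expr0n addr0 ltxx.
Qed.

Lemma v_neq0 Q : Q != 0 -> v Q != 0.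
Proof.
move=> /w_neq0; apply: contraNneq => /eqP.
by rewrite !eq_complex /= oppr_eq0.
Qed.

Lemma u_log p L Q : p = 2 * n%:R + 2 -> Q != 0 ->
  u p L Q = (2 * ln_normw Q) +i* (2 * (L * argw Q)).
Proof.
move=> pE Q0; rewrite /u pE eqxx Clog_w Clog_v//.
by apply/eqP; rewrite eq_complex /=; apply/andP; split; apply/eqP; ring.
Qed.

Lemma u_power p L Q : p != 2 * n%:R + 2 -> Q != 0 ->
  let c := half_degree p in
  u p L Q = (expR (2 * c * ln_normw Q) * cos (2 * c * L * argw Q))
    +i* (expR (2 * c * ln_normw Q) * sin (2 * c * L * argw Q)).
Proof.
move=> pE Q0 c; rewrite /u (negbTE pE) /Cpow (negbTE (w_neq0 Q0)).
rewrite (negbTE (v_neq0 Q0)) -CexpD Clog_w Clog_v//.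
rewrite /eta /tau -/(half_degree p) -/c.
rewrite (_ : _ + _ = (2 * c * ln_normw Q) +i* (2 * c * L * argw Q)).
  by rewrite /Cexp/=; apply/eqP; rewrite eq_complex /= !mul0r subr0 addr0 !eqxx.
by apply/eqP; rewrite eq_complex /=; apply/andP; split; apply/eqP; ring.
Qed.

(** The trivial phase 0 * argw puts this in the same form as [X_u_power]. *)
Lemma X_u_log p L j Q : p = 2 * n%:R + 2 -> Q != 0 ->
  X_derivable j (u p L) Q /\
  X j (u p L) Q = (2 * expR (- 2 * ln_normw Q))%:C
    * (cos (0 * argw Q) +i* sin (0 * argw Q))
    * (ln_num j Q +i* (L * arg_num j Q)).
Proof.
move=> pE Q0.
have N0 : normw Q ^+ 2 != 0 by rewrite sqrf_eq0 gt_eqF// normw_gt0.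
have uE : \near Q, (2 * ln_normw Q) +i* (2 * (L * argw Q)) = u p L Q.
  by near=> P; rewrite u_log//; near: P; exact: near_neq0.
have [||du ->] := @is_X_complex R n j Q (u p L)
  (2 * (ln_num j Q / normw Q ^+ 2)) (2 * (L * (arg_num j Q / normw Q ^+ 2))).
- apply: is_X_near; last exact: (is_XZ 2 (is_X_ln_normw j Q0)).
  by near=> P; rewrite -(near uE P).
- apply: is_X_near; last exact: (is_XZ 2 (is_XZ L (is_X_argw j Q0))).
  by near=> P; rewrite -(near uE P).
split=> //; have := expR_ln_normw (- 2) Q0.
rewrite addNr mul0r expR0 => E; rewrite mul0r cos0 sin0.
have -> : expR (- 2 * ln_normw Q) = (normw Q ^+ 2)^-1.
  by apply: (mulIf N0); rewrite E mulVf.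
by apply/eqP; rewrite eq_complex /=; apply/andP; split; apply/eqP; ring.
Unshelve. all: by end_near. Qed.

Lemma X_u_power p L j Q : p != 2 * n%:R + 2 -> Q != 0 ->
  let c := half_degree p in
  X_derivable j (u p L) Q /\
  X j (u p L) Q = (2 * c * expR ((2 * c - 2) * ln_normw Q))%:C
    * (cos (2 * c * L * argw Q) +i* sin (2 * c * L * argw Q))
    * (ln_num j Q +i* (L * arg_num j Q)).
Proof.
move=> pE Q0 c; pose b := 2 * c * L.
have N0 : normw Q != 0 by rewrite gt_eqF// normw_gt0.
have uE : \near Q, (expR (2 * c * ln_normw Q) * cos (b * argw Q))
    +i* (expR (2 * c * ln_normw Q) * sin (b * argw Q)) = u p L Q.
  by near=> P; rewrite u_power//; near: P; exact: near_neq0.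
pose D (g : R -> R) g' := expR (2 * c * ln_normw Q) *
  (2 * c * g (b * argw Q) * ln_num j Q + g' * b * arg_num j Q) / normw Q ^+ 2.
have XD (g : R -> R) g' : is_derive (b * argw Q) 1 g g' ->
    is_X j Q (fun Q => expR (2 * c * ln_normw Q) * g (b * argw Q)) (D g g').
  move=> gg'; apply: (@is_X_polar _ _ (2 * c) (fun t => g (b * t))) => //.
  apply: (@is_derive1_comp R g (fun t => b * t)) => //.
  by apply: is_derive_eq; rewrite /GRing.scale /=; ring.
have [||du ->] := @is_X_complex R n j Q (u p L)
    (D (@cos R) (- sin (b * argw Q))) (D (@sin R) (cos (b * argw Q))).
- apply: is_X_near; last exact: (XD _ _ (is_derive_cos _)).
  by near=> P; rewrite -(near uE P).
- apply: is_X_near; last exact: (XD _ _ (is_derive_sin _)).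
  by near=> P; rewrite -(near uE P).
split=> //; have := expR_ln_normw (2 * c - 2) Q0.
rewrite subrK => E; rewrite /D -E -/b.
by apply/eqP; rewrite eq_complex /=; apply/andP; split; apply/eqP;
  rewrite /b; field.
Unshelve. all: by end_near. Qed.

(** The two cases of u share one form of the differential; its exponent alpha
    meets the condition of [pLaplacian_polar] in both. *)
Lemma X_u p L : 1 < p -> exists k alpha b : R,
  2 * (alpha + 1) * ((p - 2) / 2) + alpha = - (n%:R + (p - 2) / 2 + 2) /\
  forall Q j, Q != 0 -> X_derivable j (u p L) Q /\
    X j (u p L) Q = (k * expR (alpha * ln_normw Q))%:C
      * (cos (b * argw Q) +i* sin (b * argw Q))
      * (ln_num j Q +i* (L * arg_num j Q)).
Proof.
move=> p1; have [pE|pE] := eqVneq p (2 * n%:R + 2).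
  exists 2, (- 2), 0; split; first by rewrite pE; field.
  by move=> Q j Q0; exact: X_u_log.
pose c := half_degree p; exists (2 * c), (2 * c - 2), (2 * c * L).
split; last by move=> Q j Q0; exact: X_u_power.
by rewrite /c /half_degree; field; lra.
Qed.

End Solutions.

Theorem theorem5p3 (R : realType) (n : nat) (p L : R) :
  (1 <= n)%N -> 1 < p ->
  forall P : heis R n, P != 0 ->
    [/\ forall j : 'I_(n + n), X_derivable j (u n p L) P,
        forall j : 'I_(n + n), X_derivable j (flux p L (u n p L) j) P
      & pLaplacian p L (u n p L) P = 0].
Proof.
move=> _ p1 P P0; have [k [alpha [b [alphaE Xu]]]] := @X_u R n p L p1.
have [|dF LF] := @pLaplacian_polar R n p L (k * (1 - L ^+ 2)) alpha b
    (u n p L) p1 alphaE _ P P0.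
  move=> Q Q0 j; rewrite (Upsilon_conjugate (fun i => (Xu Q i Q0).2)).
  by apply/eqP; rewrite eq_complex /=; apply/andP; split; apply/eqP; ring.
by split=> // j; case: (Xu P j P0).
Qed.
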